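(* Let $n\geq 11$ be an odd integer and let $k\leq (n-6)/2$ be a positive integer. Then $A_n^k$ is a strongly real Beauville group.
   Context: $A_n^k$ denotes the direct product of $k$ copies of the alternating group $A_n$. Let $G$ be a finite group. For $x,y\in G$ let $\Sigma(x,y):=\bigcup_{i=1}^{|G|}\bigcup_{g\in G}\{(x^i)^g,(y^i)^g,((xy)^i)^g\}$, where $a^g$ denotes the conjugate of $a$ by $g$. A Beauville structure (of unmixed type) for $G$ is a pair of generating pairs $\{\{x_1,y_1\},\{x_2,y_2\}\}$ with $x_i,y_i\in G$, such that $\langle x_1,y_1\rangle=\langle x_2,y_2\rangle=G$ and $\Sigma(x_1,y_1)\cap\Sigma(x_2,y_2)=\{e\}$, where $e$ is the identity element of $G$. A group having a Beauville structure is called a Beauville group. A Beauville group $G$ is strongly real if it has a Beauville structure $\{\{x_1,y_1\},\{x_2,y_2\}\}$ for which there exist an automorphism $\phi\in\mathrm{Aut}(G)$ and elements $g_1,g_2\in G$ such that $g_i\phi(x_i)g_i^{-1}=x_i^{-1}$ and $g_i\phi(y_i)g_i^{-1}=y_i^{-1}$ for $i=1,2$. *)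

(* Defs.v *)
From HB Require Import structures.
From mathcomp Require Import all_boot all_order all_algebra.
From mathcomp Require Import all_fingroup all_solvable.

Set Implicit Arguments.
Unset Strict Implicit.
Unset Printing Implicit Defensive.

Import GroupScope.

Definition Beauville_Sigma (gT : finGroupType) (G : {group gT}) (x y : gT)
    : {set gT} :=
  \bigcup_(1 <= i < #|G|.+1) \bigcup_(g in G)
    [set (x ^+ i) ^ g; (y ^+ i) ^ g; ((x * y) ^+ i) ^ g].

(* Membership of the four elements in G is implied by the generation
   conditions. *)
Definition Beauville_structure (gT : finGroupType) (G : {group gT})
    (x1 y1 x2 y2 : gT) : Prop :=
  [/\ <<[set x1; y1]>> = G :> {set gT},
      <<[set x2; y2]>> = G :> {set gT}
    & Beauville_Sigma G x1 y1 :&: Beauville_Sigma G x2 y2 = [set 1]].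

Definition strongly_real_structure (gT : finGroupType) (G : {group gT})
    (x1 y1 x2 y2 : gT) : Prop :=
  exists2 phi : {perm gT}, phi \in Aut G &
  exists g1 g2 : gT,
    [/\ g1 \in G,
        g2 \in G,
        g1 * phi x1 * g1^-1 = x1^-1 /\ g1 * phi y1 * g1^-1 = y1^-1
      & g2 * phi x2 * g2^-1 = x2^-1 /\ g2 * phi y2 * g2^-1 = y2^-1].

Definition strongly_real_Beauville (gT : finGroupType) (G : {group gT})
    : Prop :=
  exists x1 y1 x2 y2 : gT,
    Beauville_structure G x1 y1 x2 y2 /\ strongly_real_structure G x1 y1 x2 y2.

Definition Alt_power (n k : nat) : {group {dffun 'I_k -> {perm 'I_n}}} :=
  [group of setXn (fun _ : 'I_k => 'Alt_('I_n))].

(* Main.v *)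
Require Import Defs.
From mathcomp Require Import all_boot all_order all_algebra.
From mathcomp Require Import all_fingroup all_solvable.
From mathcomp Require Import zify.

(* Write n = 2m + 1, so that k <= m - 3. Since A_n is simple and nonabelian, a
   subgroup of A_n^k projecting onto every factor is everything as soon as, for
   all i != j, it has an element trivial at i but not at j. So it suffices to
   find, for each j < k, two generating pairs of A_n with the Beauville property,
   all inverted by one reflection t with a single fixed point o, such that two
   first (or two second) pairs are always told apart by a word.
   First pairs: two t-invariant cycles of odd lengths p = 2j + 5 and n + 1 - p
   meeting only in o. Their product is an n-cycle, x (x^y)^-1 is a 3-cycle, and
   the lengths tell the pairs apart.
   Second pairs: y is an (n-2)-cycle (o, a, ..., t a) missing f and t f, and x
   is the 3-cycle (a, o, t a) times (f, e)(t f, t e), where e = y^(j+2) o. Then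
   x y is again an (n-2)-cycle, x^4 is a 3-cycle, and x^3 (x^3)^(y^(2d)) has
   order 3 for d != j + 2, but not for d = j + 2.
   A nontrivial power in a first pair moves p, n + 1 - p or n points; these
   numbers are n or lie between 5 and n - 4, which rules out n - 2 and the powers
   of x, since x^2 and x^3 move at most 4 points. *)

Set Implicit Arguments.
Unset Strict Implicit.
Unset Printing Implicit Defensive.

Import GroupScope.

(** This is the cycle sending [e] to the first entry of [s'], each entry to the next and the last
    one back to [e], since the left factor of a product acts first. Because all transpositions share
    [e], two cycles meeting only in [e] are multiplied by concatenating their tails. *)
Definition cyc (T : finType) (s : seq T) : {perm T} :=
  if s is e :: s' then \prod_(f <- s') tperm e f else 1.

Arguments cyc {T} s : simpl never.

(** * Cycles given by lists, their powers and the points they move *)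

Section Cycles.

Variable T : finType.
Implicit Types (s : seq T) (g : {perm T}).

Lemma cyc_cons2 e f s : cyc [:: e, f & s] = tperm e f * cyc (e :: s).
Proof. by rewrite /cyc big_cons. Qed.

Lemma cycE s x : uniq s -> cyc s x = next s x.
Proof.
case: s => [|e s]; first by rewrite perm1.
elim: s x => [|f s IHs] x; first by rewrite /cyc big_nil perm1 /=; case: eqP.
rewrite cyc_cons2 permM => /= /and3P[].
rewrite inE negb_or => /andP[ne_ef e's] f's Us.
rewrite IHs /= ?e's //; case: tpermP => [->|->|/eqP ne_xe /eqP ne_xf].
- rewrite (_ : (if _ then _ else _) = next (e :: s) f) // next_nth inE eq_sym.
  by rewrite (negbTE ne_ef) (negbTE f's) eqxx.
- rewrite (eq_sym f e) (negbTE ne_ef).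
  case: s {IHs e's Us f's} => [|y s] /=; first by rewrite !eqxx.
  by rewrite !eqxx.
- rewrite (negbTE ne_xe); case: s {IHs e's Us f's} => [|y s] /=.
    by rewrite (negbTE ne_xe) (negbTE ne_xf).
  by rewrite (negbTE ne_xe) (negbTE ne_xf).
Qed.

Lemma cyc_notin s x : uniq s -> x \notin s -> cyc s x = x.
Proof. by move=> Us xs; rewrite cycE // next_nth (negbTE xs). Qed.

Lemma cyc_head e f s : uniq [:: e, f & s] -> cyc [:: e, f & s] e = f.
Proof. by move=> Us; rewrite cycE //= eqxx. Qed.

Lemma cyc_catC s1 s2 : uniq (s1 ++ s2) -> cyc (s1 ++ s2) = cyc (s2 ++ s1).
Proof.
move=> Us; apply/permP=> x; rewrite !cycE // 1?uniq_catC //.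
by rewrite -[s2 ++ s1]rot_size_cat next_rot.
Qed.

Lemma cycJ s g : cyc s ^ g = cyc (map g s).
Proof.
case: s => [|e s]; first by rewrite /cyc conj1g.
elim: s => [|f s IHs]; first by rewrite /cyc /= !big_nil conj1g.
by rewrite /= !cyc_cons2 conjMg tpermJ IHs.
Qed.

Lemma cycV s : uniq s -> (cyc s)^-1 = cyc (rev s).
Proof.
move=> Us; apply/eqP; rewrite eq_invg_mul; apply/eqP/permP=> x.
by rewrite permM perm1 !cycE ?rev_uniq // next_rev // prev_next.
Qed.

(** After a rotation that brings [e] to the front this is [cyc_cons2]; it splices an extra point [f]
    into a cycle. *)
Lemma cyc_insert s1 s2 e f : uniq (s1 ++ [:: e, f & s2]) ->
  cyc (s1 ++ [:: e, f & s2]) = tperm e f * cyc (s1 ++ e :: s2).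
Proof.
move=> Us; rewrite cyc_catC // cyc_cons2 [in RHS]cyc_catC //.
apply: subseq_uniq Us; apply: cat_subseq => //.
by rewrite -[e :: s2]cat1s -[in X in subseq _ X]cat1s cat_subseq ?subseq_cons.
Qed.

Lemma odd_cyc s : uniq s -> odd (size s) -> cyc s \in 'Alt_T.
Proof.
case: s => [|e s] //= /andP[]; rewrite Alt_even => e's _.
suff ->: odd_perm (\prod_(f <- s) tperm e f) = odd (size s) by [].
elim: s e's => [|f s IHs]; first by rewrite big_nil odd_perm1.
rewrite inE negb_or big_cons odd_permM odd_tperm => /andP[-> e's] /=.
by rewrite IHs.
Qed.

Lemma expg_cyc_nth x0 s k i : uniq s -> i < size s ->
  (cyc s ^+ k) (nth x0 s i) = nth x0 s ((i + k) %% size s).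
Proof.
move=> Us lt_i_s; elim: k => [|k IHk].
  by rewrite perm1 addn0 modn_small.
rewrite expgSr permM {}IHk addnS -[(i + k).+1]addn1 -(modnDml (i + k)) addn1.
have lt_j_s: (i + k) %% size s < size s by rewrite ltn_mod; case: size lt_i_s.
move: ((i + k) %% size s) lt_j_s => j lt_j_s {i k lt_i_s}.
rewrite cycE // next_nth mem_nth // index_uniq //.
case: s lt_j_s {Us} => // y s; rewrite /= ltnS leq_eqVlt => /predU1P[->|lt_j_s].
  by rewrite modnn nth_default.
by rewrite modn_small //= (set_nth_default x0).
Qed.

Lemma expg_cyc_notin s k x : uniq s -> x \notin s -> (cyc s ^+ k) x = x.
Proof.
move=> Us xs; elim: k => [|k IHk]; first by rewrite perm1.
by rewrite expgSr permM IHk cyc_notin.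
Qed.

Lemma expg_cyc_eq1 s k : uniq s -> size s %| k -> cyc s ^+ k = 1.
Proof.
move=> Us /eqP sk; apply/permP=> x; rewrite perm1.
have [sx|] := boolP (x \in s); last exact: expg_cyc_notin.
rewrite -{1}(nth_index x sx) expg_cyc_nth ?index_mem //.
by rewrite -modnDmr sk addn0 modn_small ?index_mem // nth_index.
Qed.

(** A power rotates the positions, so a single fixed position forces the shift to vanish modulo the
    length. *)
Lemma expg_cyc_fix s k x : uniq s -> x \in s ->
  (cyc s ^+ k) x = x -> size s %| k.
Proof.
move=> Us sx fix_x; have lt_i_s : index x s < size s by rewrite index_mem.
have := expg_cyc_nth x k Us lt_i_s.
rewrite nth_index // fix_x -{1}(nth_index x sx) => /eqP.
rewrite nth_uniq ?ltn_mod //; last by case: (s) sx.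
rewrite -{1}(modn_small lt_i_s) -{1}[index x s]addn0 eqn_modDl mod0n eq_sym.
by [].
Qed.

Definition moved g : {set T} := [set x | g x != x].

Lemma card_movedJ g h : #|moved (g ^ h)| = #|moved g|.
Proof.
suff ->: moved (g ^ h) = h @: moved g by rewrite card_imset //; apply: perm_inj.
apply/setP=> x; rewrite -(permKV h x) mem_imset ?inE; last exact: perm_inj.
by rewrite permJ (inj_eq perm_inj).
Qed.

Lemma moved_expg g k : moved (g ^+ k) \subset moved g.
Proof.
apply/subsetP=> x; rewrite !inE; apply: contraNneq => gx.
by apply/eqP; elim: k => [|k IHk]; rewrite ?perm1 // expgS permM gx.
Qed.

Lemma moved_expg_cyc s k : uniq s ->
  cyc s ^+ k != 1 -> moved (cyc s ^+ k) = [set x in s].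
Proof.
move=> Us n1; apply/setP=> x; rewrite !inE.
have [sx|xs] := boolP (x \in s); last by rewrite expg_cyc_notin ?eqxx.
by apply: contraNneq n1 => /(expg_cyc_fix Us sx)/(expg_cyc_eq1 Us)->.
Qed.

Lemma expg_cyc_neq1 s d :
  uniq s -> 0 < d < size s -> cyc s ^+ d != 1.
Proof.
case: s => [|e s] Us /andP[d_gt0 d_lt]; first by rewrite ltn0 in d_lt.
apply/eqP=> /permP/(_ e); rewrite perm1 => /(expg_cyc_fix Us (mem_head _ _)).
by move/(dvdn_leq d_gt0); rewrite leqNgt d_lt.
Qed.

(** Conjugation keeps the number of moved points, and every nontrivial power of a cycle moves
    exactly as many points as the cycle is long. *)
Lemma cyc_expg_conj_eq1 s1 s2 i1 i2 g1 g2 :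
    uniq s1 -> uniq s2 -> size s1 != size s2 ->
  (cyc s1 ^+ i1) ^ g1 = (cyc s2 ^+ i2) ^ g2 -> (cyc s1 ^+ i1) ^ g1 = 1.
Proof.
move=> U1 U2 ne12 eq12; apply: contraNeq ne12 => ne1.
have n1 : cyc s1 ^+ i1 != 1 by rewrite -(conjg_eq1 _ g1).
have n2 : cyc s2 ^+ i2 != 1 by rewrite -(conjg_eq1 _ g2) -eq12.
have := card_movedJ (cyc s1 ^+ i1) g1; rewrite {1}eq12 card_movedJ.
by rewrite !moved_expg_cyc // !cardsE (card_uniqP U1) (card_uniqP U2) => ->.
Qed.

End Cycles.

(** * A criterion for a permutation group to contain the alternating group *)

Section AltGeneration.

Variables (T : finType) (H : {group {perm T}}) (u v : T).

(* tperm a b and tperm u v agree modulo H *)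
Definition linked a b := (a == b) || (tperm a b * tperm u v \in H).

Lemma linked_sym a b : linked a b = linked b a.
Proof. by rewrite /linked eq_sym tpermC. Qed.

Lemma linked_tpermV a b :
  tperm a b * tperm u v \in H -> tperm u v * tperm a b \in H.
Proof. by move=> Hab; rewrite -groupV invMg !tpermV. Qed.

(** [(a c)] is [(a b)] conjugated by [(b c)]; inserting [(u v)(u v)] turns [(a c)(u v)] into a
    product of three elements of [H]. *)
Lemma linked_trans b a c : linked a b -> linked b c -> linked a c.
Proof.
rewrite /linked; have [-> //|ne_ab] := eqVneq a b.
have [<- /= ->|ne_bc] := eqVneq b c; first by rewrite orbT.
have [//|ne_ac] /= := eqVneq a c; move=> Hab Hbc.
have ->: tperm a c * tperm u v = (tperm b c * tperm u v) *
    (tperm u v * tperm a b) * (tperm b c * tperm u v).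
  rewrite -!mulgA [tperm u v * (tperm u v * _)]mulgA tperm2 mul1g 2!mulgA.
  congr (_ * _); rewrite -mulgA -{1}(tpermV b c) -conjgE tpermJ tpermL.
  by rewrite tpermD // eq_sym.
exact: groupM (groupM Hbc (linked_tpermV Hab)) Hbc.
Qed.

Lemma linked_3cycle a b c : a != b -> a != c -> tperm a b * tperm a c \in H ->
  linked a b = linked a c.
Proof.
move=> /negbTE ne_ab /negbTE ne_ac Habc; rewrite /linked ne_ab ne_ac /=.
rewrite -(groupMl (tperm a c * tperm u v) Habc) -mulgA (mulgA (tperm a c)).
by rewrite tperm2 mul1g.
Qed.

Lemma Alt_sub_linked : (forall a b, linked a b) -> 'Alt_T \subset H.
Proof.
move=> linkH; apply/subsetP=> s; rewrite Alt_even.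
have [ts -> ts_neq] := prod_tpermP s => even_ts.
(* The factor [tperm u v] makes up for an odd number of transpositions, so that the induction can
   add one transposition at a time. *)
suff: (if odd_perm (\prod_(t <- ts) tperm t.1 t.2) then tperm u v else 1)
    * \prod_(t <- ts) tperm t.1 t.2 \in H by rewrite (negbTE even_ts) mul1g.
elim: ts ts_neq {even_ts s} => [|[a b] ts IHts] /=.
  by rewrite big_nil odd_perm1 mulg1.
case/andP=> ne_ab /IHts; rewrite /= in ne_ab.
have /orP[/eqP eq_ab|Hab] := linkH a b; first by rewrite eq_ab eqxx in ne_ab.
rewrite big_cons odd_permM odd_tperm ne_ab /=.
case: odd_perm => /= Hts; rewrite mul1g in Hts *.
  by have := groupM Hab Hts; rewrite -mulgA (mulgA (tperm u v)) tperm2 mul1g.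
by rewrite mulgA; apply: groupM Hts; apply: linked_tpermV.
Qed.

End AltGeneration.

(** * Subdirect subgroups of powers of a nonabelian simple group *)

Section SubdirectPower.

Variables (I : finType) (rT : finGroupType).
Variables (S : {group rT}) (H : {group {dffun I -> rT}}).

Lemma conjg_ffun (g h : {dffun I -> rT}) i : (g ^ h) i = g i ^ h i.
Proof. by rewrite conjgE !mulg_ffun invg_ffun. Qed.

Lemma expg_ffun (g : {dffun I -> rT}) d i : (g ^+ d) i = g i ^+ d.
Proof.
by elim: d => [|d IHd]; rewrite ?oneg_ffun // !expgS mulg_ffun IHd.
Qed.

Lemma commg_ffun (g h : {dffun I -> rT}) i : [~ g, h] i = [~ g i, h i].
Proof. by rewrite commgEl mulg_ffun invg_ffun conjg_ffun. Qed.

Lemma simple_center : simple S -> ~~ abelian S -> 'Z(S) = 1.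
Proof.
case/simpleP=> _ simS nabS.
have [//|/center_idP cSS] := simS _ (center_normal S).
by rewrite cSS in nabS.
Qed.

(* Commutators of elements of H trivial at i with elements trivial on r are
   trivial on i :: r; simplicity makes their values at j fill S. *)
Lemma subdirect_power_full : simple S -> ~~ abelian S ->
    H \subset setXn (fun _ : I => S) ->
    (forall i s, s \in S -> exists2 h : {dffun I -> rT}, h \in H & h i = s) ->
    (forall i j, i != j ->
       exists h : {dffun I -> rT}, [/\ h \in H, h i = 1 & h j != 1]) ->
  H = setXn (fun _ : I => S) :> {set _}.
Proof.
move=> simS nabS sHS projH sepH; have Z1 := simple_center simS nabS.
have HS h j : h \in H -> h j \in S by move=> /(subsetP sHS)/setXnP.
have kerH j (r : seq I) : j \notin r -> forall s, s \in S ->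
    exists h : {dffun I -> rT},
      [/\ h \in H, h j = s & forall i, i \in r -> h i = 1].
  elim: r => [|i r IHr] /=.
    by move=> _ s /(projH j)[h Hh <-]; exists h.
  rewrite inE negb_or => /andP[ne_ji /IHr{}IHr].
  pose K := (H :&: setXn (fun l => if l \in i :: r then 1 else [set: rT]%G))%G.
  have KP (h : {dffun I -> rT}) :
      reflect (h \in H /\ forall l, l \in i :: r -> h l = 1) (h \in K).
    apply: (iffP setIP) => [][Hh h1]; split=> //.
      by move=> l lr; have := setXnP h1 l; rewrite lr => /set1P.
    by apply/setXnP=> l; case: ifP => [/h1->|_]; rewrite inE.
  (* [N] is normal in [S]: [K] is stable under conjugation by [H], and [H] projects onto [S]. *)
  pose N := (@dffun_morphism I (fun=> rT) j @* K)%G.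
  have NP s : reflect (exists2 h, h \in K & h j = s) (s \in N).
    apply: (iffP morphimP) => [[h _ Kh ->]|[h Kh <-]]; first by exists h.
    by exists h; rewrite ?in_setT.
  have [_ /(_ N)[]] := simpleP _ simS.
  - apply/andP; split.
      by apply/subsetP=> _ /NP[h /KP[Hh _] <-]; apply: HS.
    apply/normsP=> s Ss; apply/normP; rewrite inE.
    apply/subsetP=> _ /imsetP[_ /NP[h /KP[Hh h1] <-] ->].
    have [g Hg <-] := projH j s Ss; apply/NP; exists (h ^ g).
      apply/KP; split; first exact: groupJ.
      by move=> l /h1 hl; rewrite conjg_ffun hl conj1g.
    by rewrite conjg_ffun.
  - have [|h [Hh hi hj]] := sepH i j; first by rewrite eq_sym.
    (* If [N] were trivial, [h j] would commute with all of [S], every [s] being the value at [j] of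
       some [g] trivial on [r]; this contradicts the trivial center. *)
    move=> N1; case/eqP: hj; apply/set1P; rewrite -[[set 1]]Z1.
    apply/centerP; split=> [|s /IHr[g [Hg gj g1]]]; first exact: HS.
    apply/commgP; rewrite -gj.
    have /NP: exists2 h' : {dffun I -> rT}, h' \in K & h' j = [~ h, g] j.
      exists [~ h, g] => //.
      apply/KP; split; first by rewrite groupR.
      move=> l /predU1P[->|lr]; rewrite commg_ffun; first by rewrite hi comm1g.
      by rewrite g1 // commg1.
    by rewrite N1 commg_ffun => /set1P ->.
  - by move=> NS s; rewrite -NS => /NP[h /KP[Hh h1] <-]; exists h.
apply/eqP; rewrite eqEsubset sHS -(setXn_prod (fun=> S)).
rewrite prod_subG // => j _; apply/subsetP=> _ /set1gXnP[s Ss ->].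
(* With all indices other than [j] in the list, [H] contains the whole [j]-th factor. *)
have [|h [Hh hj h1]] := kerH j (enum (predC1 j)) _ s Ss.
  by rewrite mem_enum !inE eqxx.
suff ->: @dfung1 I (fun=> rT) j s = h by [].
apply/ffunP=> l; have [<-|ne_jl] := eqVneq j l; first by rewrite dfung1_id.
by rewrite dfung1_dflt // h1 // mem_enum !inE eq_sym.
Qed.

End SubdirectPower.

(** Proves that two entries of a duplicate-free list differ: identifying them makes the [uniq] in
    [U] compute to [false]. *)
Ltac uniq_neq U :=
  by apply: contraTneq (U) => ->; rewrite /= !inE !eqxx /= ?orbT /= ?andbF.

(** * Generation by two cycles meeting in one point *)

Section Generators.

Variable T : finType.

Lemma expg_cyc_head (e : T) s z : uniq (e :: s) -> z \in e :: s ->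
  (cyc (e :: s) ^+ index z (e :: s)) e = z.
Proof.
move=> Us sz; have := expg_cyc_nth e (index z (e :: s)) Us (ltn0Sn _).
by rewrite add0n modn_small ?index_mem // nth_index.
Qed.

(** Starting the list at [l] instead of [e] lets the first transposition split off, leaving a cycle
    that avoids [e]. *)
Lemma cyc_rcons (e l : T) s : uniq (e :: rcons s l) ->
  cyc (e :: rcons s l) = tperm l e * cyc (l :: s).
Proof.
move=> Us; rewrite -cyc_cons2 -[in RHS]cat1s -(cyc_catC (s1 := e :: s)).
  by rewrite cats1.
by rewrite cats1.
Qed.

(** With [l] last in [r1] and [b] first in [r2], the element [x (x^y)^-1] is the 3-cycle
    [(l o)(l b)], whose conjugates link every point to [l]. *)
Lemma Alt_sub_gen_cyc2 o (r1 r2 : seq T) : uniq (o :: r1 ++ r2) ->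
    r1 != [::] -> r2 != [::] -> (forall z, z \in o :: r1 ++ r2) ->
  'Alt_T \subset <<[set cyc (o :: r1); cyc (o :: r2)]>>.
Proof.
case: r2 => // b r2; case/lastP: r1 => // f1 l Us _ _ full.
set r1 := rcons f1 l in Us full *; set x := cyc _; set y := cyc _.
pose H := <<[set x; y]>>%G; rewrite -[<<_>>]/(gval H).
have Hx : x \in H by rewrite mem_gen ?set21.
have Hy : y \in H by rewrite mem_gen ?set22.
have [or' Ur] := andP (Us : (o \notin r1 ++ b :: r2) && uniq (r1 ++ b :: r2)).
move: or'; rewrite mem_cat negb_or => /andP[or1 or2].
move: Ur; rewrite cat_uniq => /and3P[Ur1 r12 Ur2].
have Ux : uniq (o :: r1) by rewrite /= or1.
have Uy : uniq (o :: b :: r2) by rewrite /= or2.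
have notin1 z : z \in b :: r2 -> z \notin o :: r1.
  move=> r2z; rewrite inE negb_or; apply/andP; split.
    by apply: contraNneq or2 => <-.
  by apply: contra r12 => r1z; apply/hasP; exists z.
have notin2 z : z \in r1 -> z \notin o :: b :: r2.
  move=> r1z; rewrite inE negb_or; apply/andP; split.
    by apply: contraNneq or1 => <-.
  by apply: contra r12 => r2z; apply/hasP; exists z.
have r1l : l \in r1 by rewrite mem_rcons mem_head.
have xb i : (x ^+ i) b = b by rewrite expg_cyc_notin // notin1 ?mem_head.
have yl i : (y ^+ i) l = l by rewrite expg_cyc_notin // notin2.
have yo : y o = b by rewrite [y]/(cyc _) cyc_head.
have H3 : tperm l o * tperm l b \in H.
  have: x * (x ^ y)^-1 \in H by rewrite groupM ?groupV ?groupJ.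
  (* Since [y] sends [o] to [b] and fixes [r1] pointwise, [x ^ y] is [x] with [b] in place of [o];
     the common factor [cyc (l :: f1)] then cancels. *)
  have ->: x ^ y = tperm l b * cyc (l :: f1).
    rewrite -cyc_rcons ?cycJ; last first.
      have := notin1 b (mem_head _ _); rewrite inE negb_or => /andP[_ br1].
      by rewrite /= br1.
    congr cyc; rewrite /= yo; congr (_ :: _); rewrite -[RHS]map_id.
    by apply/eq_in_map=> z r1z; exact: (cyc_notin Uy (notin2 z r1z)).
  by rewrite (cyc_rcons Ux : x = _) invMg tpermV mulgA mulgK.
have ne_lo : l != o by apply: contraNneq or1 => <-.
have ne_lb : l != b.
  by apply: contraNneq (notin1 b (mem_head _ _)) => <-; rewrite inE r1l orbT.
have ne_ob : o != b by apply: contraNneq or2 => ->; rewrite mem_head.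
have lo : linked H l o l o by rewrite /linked tperm2 group1 orbT.
have lb : linked H l o l b by rewrite -(linked_3cycle l o ne_lo ne_lb H3).
apply: (@Alt_sub_linked _ H l o).
suff lz z : linked H l o l z.
  by move=> z1 z2; apply: linked_trans (lz z2); rewrite linked_sym.
have := full z; rewrite -cat_cons mem_cat => /orP[xz|yz].
  rewrite -(expg_cyc_head Ux xz) -/x; elim: (index z _) => [|i IHi].
    by rewrite perm1.
  have xlo: x l = o.
    rewrite (cyc_rcons Ux : x = _) permM tpermL cyc_notin //.
      by rewrite rcons_uniq in Ur1.
    rewrite inE eq_sym (negbTE ne_lo).
    by move: or1; rewrite mem_rcons inE negb_or => /andP[].
  (* As [x l = o] and [x] fixes [b], conjugating by [x ^+ i.+1] gives a 3-cycle on [b] and two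
     successive points of the [x]-orbit; [b] is already linked to [l]. *)
  have H3i: tperm ((x ^+ i) o) ((x ^+ i.+1) o) * tperm ((x ^+ i) o) b \in H.
    have := groupJ H3 (groupX i.+1 Hx).
    by rewrite conjMg !tpermJ xb expgS permM xlo.
  have nxb: (x ^+ i) o != b by rewrite -(xb i) (inj_eq perm_inj).
  have nxx: (x ^+ i) o != (x ^+ i.+1) o.
    by rewrite expgS permM (inj_eq perm_inj) -{1}xlo (inj_eq perm_inj).
  have := linked_3cycle l o nxx nxb H3i.
  have ->: linked H l o ((x ^+ i) o) b.
    by apply: linked_trans lb; rewrite linked_sym.
  exact: linked_trans.
have {yz}: z \in o :: b :: r2 by rewrite inE yz orbT.
move/(expg_cyc_head Uy) <-; rewrite -/y.
elim: (index z _) => [|i IHi]; first by rewrite perm1.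
(* Here [l] is fixed by [y], and the conjugate 3-cycle joins [l] to two successive points of the
   [y]-orbit. *)
have H3i: tperm l ((y ^+ i) o) * tperm l ((y ^+ i.+1) o) \in H.
  by have := groupJ H3 (groupX i Hy); rewrite conjMg !tpermJ yl -yo expgS permM.
rewrite -(linked_3cycle l o _ _ H3i) // -(yl i) 1?expgS ?permM (inj_eq perm_inj).
  by [].
by rewrite yo.
Qed.

(** * Elements of cycle type (3,2,2), and generation by one of them and a long cycle *)

Section ThreeTwoTwo.

Variables (o a a' e e' f f' : T).
Hypothesis U7 : uniq [:: f; f'; o; a; a'; e; e'].

Lemma uniq_rot3 : uniq [:: o; a'; a].
Proof.
rewrite /= !inE !andbT !negb_or.
by apply/andP; split; [apply/andP; split|]; uniq_neq U7.
Qed.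

(** Ordered so as to cancel against the factors [(o a)(a' o)] that split off a cycle starting with
    [o, a] and ending in [a']. *)
Definition rot3 := tperm a' o * tperm o a.
Definition swap2 := tperm f e * tperm f' e'.
Definition elt322 := rot3 * swap2.

Lemma rot3E : rot3 = cyc [:: o; a'; a].
Proof. by rewrite !cyc_cons2 /cyc big_nil mulg1 /rot3 tpermC. Qed.

Lemma swap2_out z : z \notin [:: f; e; f'; e'] -> swap2 z = z.
Proof.
rewrite !inE !negb_or => /and4P[zf ze zf' ze'].
by rewrite permM !tpermD // eq_sym.
Qed.

Lemma rot3_out z : z \notin [:: o; a'; a] -> rot3 z = z.
Proof. by rewrite rot3E; apply: cyc_notin; apply: uniq_rot3. Qed.

Lemma commute_rot3_swap2 : commute rot3 swap2.
Proof.
by apply/commgP/conjg_fixP; rewrite conjMg !tpermJ !swap2_out // !inE !negb_or;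
  apply/and4P; split; uniq_neq U7.
Qed.

Lemma commute_swap2 : commute (tperm f e) (tperm f' e').
Proof.
by apply/commgP/conjg_fixP; rewrite tpermJ !tpermD //; uniq_neq U7.
Qed.

Lemma swap2_sqr : swap2 ^+ 2 = 1.
Proof.
by rewrite (expgMn _ commute_swap2) !expgS !mulg1 !tperm2 mulg1.
Qed.

Lemma rot3_cube : rot3 ^+ 3 = 1.
Proof. by rewrite rot3E expg_cyc_eq1 //; apply: uniq_rot3. Qed.

Lemma elt322_exp3 : elt322 ^+ 3 = swap2.
Proof.
by rewrite (expgMn _ commute_rot3_swap2) rot3_cube expgSr swap2_sqr !mul1g.
Qed.

Lemma elt322_exp4 : elt322 ^+ 4 = rot3.
Proof.
rewrite (expgMn _ commute_rot3_swap2) expgSr rot3_cube mul1g.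
by rewrite (expgM _ 2 2) swap2_sqr expg1n mulg1.
Qed.

Lemma elt322_Alt : elt322 \in 'Alt_T.
Proof.
rewrite groupM //; first by rewrite rot3E odd_cyc //; apply: uniq_rot3.
rewrite Alt_even odd_permM !odd_tperm.
have ->: f != e by uniq_neq U7.
by have ->: f' != e' by uniq_neq U7.
Qed.

Lemma card_moved_exp2 : #|moved (elt322 ^+ 2)| <= 3.
Proof.
rewrite (expgMn _ commute_rot3_swap2) swap2_sqr mulg1.
apply: leq_trans (subset_leq_card (moved_expg _ _)) _.
have: moved rot3 \subset [set x in [:: o; a'; a]].
  by apply/subsetP=> z; rewrite inE in_set; apply: contraR => /rot3_out->.
by move/subset_leq_card/leq_trans; apply; rewrite cardsE card_size.
Qed.

Lemma card_moved_exp3 : #|moved (elt322 ^+ 3)| <= 4.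
Proof.
rewrite elt322_exp3.
have: moved swap2 \subset [set x in [:: f; e; f'; e']].
  by apply/subsetP=> z; rewrite inE in_set; apply: contraR => /swap2_out->.
by move/subset_leq_card/leq_trans; apply; rewrite cardsE card_size.
Qed.

(** For [d = 2, 3], [w ^+ d] is conjugate to a power of [elt322 ^+ d], which moves at most 4 points,
    and to a power of [cyc c], which moves no point or more than 4. Hence [w ^+ 2 = w ^+ 3 = 1]. *)
Lemma elt322_conj_eq1 (c : seq T) i g w k h : uniq c -> 4 < size c ->
  w = (elt322 ^+ i) ^ g -> w = (cyc c ^+ k) ^ h -> w = 1.
Proof.
move=> Uc c_gt4 w322 wc.
have w_exp d : #|moved (elt322 ^+ d)| < size c -> w ^+ d = 1.
  move=> lt_d; apply: contraTeq lt_d; rewrite -leqNgt.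
  rewrite {1}wc -conjXg conjg_eq1 -expgM => /(moved_expg_cyc Uc) moved_c.
  have <-: #|moved (w ^+ d)| = size c.
    by rewrite wc -conjXg card_movedJ -expgM moved_c cardsE (card_uniqP Uc).
  rewrite w322 -conjXg card_movedJ -expgM mulnC expgM.
  by rewrite subset_leq_card ?moved_expg.
have: w ^+ 3 = 1 by apply: w_exp; apply: leq_ltn_trans card_moved_exp3 _.
rewrite expgSr w_exp ?mul1g //.
by apply: leq_ltn_trans card_moved_exp2 _; apply: ltn_trans c_gt4.
Qed.

Lemma elt322J (t : {perm T}) : t o = o -> t a = a' -> t a' = a -> t e = e' ->
  t e' = e -> t f = f' -> t f' = f -> elt322 ^ t = elt322^-1.
Proof.
move=> to ta ta' te te' tf tf'.
rewrite {1}(commute_rot3_swap2 : elt322 = _) !conjMg !tpermJ.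
rewrite to ta ta' te te' tf tf' !invMg !tpermV.
by rewrite [tperm o a]tpermC [tperm o a']tpermC.
Qed.

(** The factor [rot3] deletes [o] and [a] from the cycle, and the two transpositions of [swap2]
    insert [f] after [e] and [f'] after [e'], so the length is unchanged. *)
Lemma elt322_mul_cyc q1 q2 q3 :
    uniq [:: f, f', o, a & q1 ++ e :: q2 ++ e' :: rcons q3 a'] ->
  elt322 * cyc [:: o, a & q1 ++ e :: q2 ++ e' :: rcons q3 a'] =
  cyc (q1 ++ [:: e, f & q2] ++ [:: e', f' & rcons q3 a']).
Proof.
move=> Uq; set q := q1 ++ e :: q2 ++ e' :: q3.
have qE: q1 ++ e :: q2 ++ e' :: rcons q3 a' = rcons q a'.
  by rewrite rcons_cat rcons_cons rcons_cat rcons_cons.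
have /and3P[_ _ Uoa]: [&& f \notin f' :: o :: a :: rcons q a',
    f' \notin o :: a :: rcons q a' & uniq (o :: a :: rcons q a')].
  by rewrite -qE.
have Uoq: uniq (o :: rcons q a').
  by move: Uoa => /= /and3P[]; rewrite inE negb_or => /andP[_ ->].
have Ueq : uniq (q1 ++ [:: e, f & q2] ++ [:: e', f' & rcons q3 a']).
  have <-: uniq ([:: f; f'] ++ (q1 ++ e :: q2 ++ e' :: rcons q3 a')) =
      uniq (q1 ++ [:: e, f & q2] ++ [:: e', f' & rcons q3 a']).
    by apply/perm_uniq/seq.permP=> p; rewrite !count_cat /= !count_cat /=; lia.
  apply: subseq_uniq Uq.
  exact: cat_subseq (prefix_subseq [:: f; f'] [:: o; a]) (subseq_refl _).
have rotE: cyc (o :: rcons q a') = tperm a' o * cyc (rcons q a').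
  rewrite cyc_rcons //; congr (_ * _); rewrite -cat1s cyc_catC ?cats1 //.
  by move: Uoq; rewrite /= rcons_uniq => /andP[].
rewrite qE cyc_cons2 rotE.
have ->: elt322 * (tperm o a * (tperm a' o * cyc (rcons q a'))) =
    swap2 * cyc (rcons q a').
  rewrite (commute_rot3_swap2 : elt322 = _) /rot3 -!mulgA; congr (_ * _).
  by rewrite (mulgA (tperm o a)) tperm2 mul1g (mulgA (tperm a' o)) tperm2 mul1g.
rewrite -qE cyc_insert // -mulgA [tperm e f]tpermC; congr (_ * _).
rewrite -2!cat_cons !catA cyc_insert; first by rewrite tpermC -!catA.
apply: subseq_uniq Ueq; rewrite -catA; apply: cat_subseq => //.
exact: (cat_subseq (subseq_refl [:: e]) (subseq_cons _ f)).
Qed.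

Lemma Alt_sub_gen322 r : uniq (o :: a :: rcons r a') ->
    e \in o :: a :: rcons r a' -> e' \in o :: a :: rcons r a' ->
    (forall z, z \in [:: f, f', o, a & rcons r a']) ->
  'Alt_T \subset <<[set elt322; cyc (o :: a :: rcons r a')]>>.
Proof.
move=> Uq qe qe' full; set y := cyc _; pose H := <<[set elt322; y]>>%G.
rewrite -[<<_>>]/(gval H); have Hx : elt322 \in H by rewrite mem_gen ?set21.
have Hy : y \in H by rewrite mem_gen ?set22.
have H3 : rot3 \in H by rewrite -elt322_exp4 groupX.
have H2 : swap2 \in H by rewrite -elt322_exp3 groupX.
have yo : y o = a by exact: cyc_head.
have ya' : y a' = o.
  have Uq' : uniq (o :: rcons (a :: r) a') by [].
  rewrite (cyc_rcons Uq' : y = _) permM tpermL cyc_notin //.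
    suff: uniq (rcons (a :: r) a') by rewrite rcons_uniq.
    by case/andP: Uq'.
  suff: o \notin rcons (a :: r) a' by rewrite mem_rcons.
  by case/andP: Uq'.
apply: (@Alt_sub_linked _ H o a).
suff oz z : linked H o a o z.
  by move=> z1 z2; apply: linked_trans (oz z2); rewrite linked_sym.
have oy i : linked H o a o ((y ^+ i) o).
  (* Conjugates of [rot3] only pass a link from one step of the [y]-orbit to the next, so the
     induction must carry the current step along. *)
  suff: linked H o a o ((y ^+ i) o) &&
      linked H o a ((y ^+ i) o) ((y ^+ i.+1) o).
    by case/andP.
  elim: i => [|i /andP[IHi IHiS]].
    by rewrite perm1 expg1 yo /linked eqxx tperm2 group1 orbT.
  rewrite (linked_trans IHi IHiS) /=.
  have H3i: tperm ((y ^+ i.+1) o) ((y ^+ i) o)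
      * tperm ((y ^+ i.+1) o) ((y ^+ i.+2) o) \in H.
    have := groupJ H3 (groupX i.+1 Hy).
    have ->: (y ^+ i.+2) o = (y ^+ i.+1) a by rewrite [y ^+ i.+2]expgS permM yo.
    have ->: (y ^+ i) o = (y ^+ i.+1) a' by rewrite expgS permM ya'.
    by rewrite conjMg !tpermJ [tperm _ ((y ^+ i.+1) a')]tpermC.
  rewrite -(linked_3cycle o a _ _ H3i) 1?linked_sym //.
  - by rewrite expgS permM yo (inj_eq perm_inj); uniq_neq U7.
  - by rewrite [y ^+ i.+2]expgS permM yo (inj_eq perm_inj); uniq_neq U7.
have oq p : p \in o :: a :: rcons r a' -> linked H o a o p.
  by move/(expg_cyc_head Uq) <-.
(* Since [swap2] fixes [o] and [a], conjugation by it turns a link from [o] to [p] into one from [o]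
   to [swap2 p]; this reaches [f] and [f'], which [y] misses. *)
have o_swap p : p \in o :: a :: rcons r a' -> p != o ->
    linked H o a o (swap2 p).
  move=> /oq; rewrite linked_sym => /orP[->//|Hz] _.
  rewrite linked_sym; apply/orP; right.
  have := groupJ Hz H2.
  rewrite conjMg !tpermJ [swap2 o]swap2_out ?[swap2 a]swap2_out //;
    by rewrite !inE !negb_or; apply/and4P; split; uniq_neq U7.
have := full z; rewrite !inE => /or3P[/eqP->|/eqP->|qz].
- have ->: f = swap2 e by rewrite permM tpermR tpermD //; uniq_neq U7.
  by apply: o_swap => //; uniq_neq U7.
- have ->: f' = swap2 e'.
    by rewrite permM [tperm f e e']tpermD ?tpermR //; uniq_neq U7.
  by apply: o_swap => //; uniq_neq U7.
- by apply: oq; rewrite !inE.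
Qed.

End ThreeTwoTwo.

End Generators.

(** * Noncommutativity of alternating groups, and elements of [Beauville_Sigma] *)

Lemma Alt_not_abelian n : 3 < n -> ~~ abelian 'Alt_('I_n).
Proof.
case: n => [|[|[|[|n]]]] // _; apply/negP=> /centsP cAA.
pose i0 : 'I_n.+4 := Ordinal (isT : 0 < n.+4).
pose i1 : 'I_n.+4 := Ordinal (isT : 1 < n.+4).
pose i2 : 'I_n.+4 := Ordinal (isT : 2 < n.+4).
pose i3 : 'I_n.+4 := Ordinal (isT : 3 < n.+4).
have A2: tperm i0 i1 * tperm i0 i2 \in 'Alt_('I_n.+4).
  by rewrite Alt_even odd_permM !odd_tperm.
have A3: tperm i0 i1 * tperm i0 i3 \in 'Alt_('I_n.+4).
  by rewrite Alt_even odd_permM !odd_tperm.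
by have /permP/(_ i2) := cAA _ A2 _ A3; rewrite !permM !permE.
Qed.

Lemma mem_Beauville_Sigma (gT : finGroupType) (G : {group gT}) x y w :
  w \in Beauville_Sigma G x y ->
  exists i g, [\/ w = (x ^+ i) ^ g, w = (y ^+ i) ^ g | w = ((x * y) ^+ i) ^ g].
Proof.
rewrite /Beauville_Sigma big_nat_cond; elim/big_ind: _ => [|A B IA IB|i _].
- by rewrite inE.
- by case/setUP.
case/bigcupP=> g _; rewrite !inE -orbA => /or3P[]/eqP->; exists i, g.
- by constructor 1.
- by constructor 2.
- by constructor 3.
Qed.

Lemma one_Beauville_Sigma (gT : finGroupType) (G : {group gT}) x y :
  x \in G -> 1 \in Beauville_Sigma G x y.
Proof.
(* The identity comes from the last exponent, [#|G|]. *)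
move=> Gx; rewrite /Beauville_Sigma big_nat_recr ?cardG_gt0 //=.
apply/setUP; right; apply/bigcupP; exists 1; rewrite ?group1 //.
by rewrite !inE conjg1 expg_cardG ?eqxx.
Qed.

(** * From coordinatewise data to a strongly real structure on the power *)

Section Assembly.

Variables (n k : nat) (x1 y1 x2 y2 : {dffun 'I_k -> {perm 'I_n}}).
Variable t : {perm 'I_n}.

Definition separates (x y : {dffun 'I_k -> {perm 'I_n}}) :=
  forall i j, i != j -> exists h : {dffun 'I_k -> {perm 'I_n}},
    [/\ h \in <<[set x; y]>>, h i = 1 & h j != 1].

Lemma gen_Alt_power (x y : {dffun 'I_k -> {perm 'I_n}}) : 4 < n ->
    (forall j, <<[set x j; y j]>> = 'Alt_('I_n)) -> separates x y ->
  <<[set x; y]>> = Alt_power n k :> {set _}.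
Proof.
move=> n_gt4 genA sep.
have simA : simple 'Alt_('I_n) by apply: simple_Alt5; rewrite card_ord.
have mem_gen2 j z : z \in [set x j; y j] -> z \in 'Alt_('I_n).
  by rewrite -(genA j) => /mem_gen.
apply: subdirect_power_full => //.
- by apply: Alt_not_abelian; apply: ltnW.
- rewrite gen_subG; apply/subsetP=> z.
  by case/set2P=> ->; apply/setXnP=> j; apply: (mem_gen2 j);
    rewrite ?set21 ?set22.
- move=> i s As; have: s \in <<[set x i; y i]>> by rewrite genA.
  have ->: <<[set x i; y i]>> =
      @dffun_morphism 'I_k (fun=> {perm 'I_n}) i @* <<[set x; y]>>.
    by rewrite morphim_gen ?subsetT // morphimU !morphim_set1 ?inE.
  by case/morphimP=> h _ Hh ->; exists h.
Qed.

Hypothesis n_gt4 : 4 < n.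
Hypothesis gen1 : forall j, <<[set x1 j; y1 j]>> = 'Alt_('I_n).
Hypothesis gen2 : forall j, <<[set x2 j; y2 j]>> = 'Alt_('I_n).
Hypothesis sep1 : separates x1 y1.
Hypothesis sep2 : separates x2 y2.
Hypothesis disj : forall j c d i g i' g',
  c \in [:: x1 j; y1 j; x1 j * y1 j] -> d \in [:: x2 j; y2 j; x2 j * y2 j] ->
  (c ^+ i) ^ g = (d ^+ i') ^ g' -> (c ^+ i) ^ g = 1.
Hypothesis inv_t : forall j,
  [/\ x1 j ^ t = (x1 j)^-1, y1 j ^ t = (y1 j)^-1,
      x2 j ^ t = (x2 j)^-1 & y2 j ^ t = (y2 j)^-1].

(** An element common to both [Beauville_Sigma] sets is, at each [j], conjugate to a power of a
    member of either [j]-th triple, so [disj] makes every coordinate trivial. *)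
Lemma strongly_real_Alt_power : strongly_real_Beauville (Alt_power n k).
Proof.
exists x1, y1, x2, y2; split.
  split; [exact: gen_Alt_power..|]; apply/eqP; rewrite eqEsubset sub1set andbC.
  have Gx1: x1 \in Alt_power n k.
    by apply/setXnP=> j; have: x1 j \in <<[set x1 j; y1 j]>>;
      [rewrite mem_gen ?set21 | rewrite gen1].
  have Gx2: x2 \in Alt_power n k.
    by apply/setXnP=> j; have: x2 j \in <<[set x2 j; y2 j]>>;
      [rewrite mem_gen ?set21 | rewrite gen2].
  rewrite inE !one_Beauville_Sigma //=.
  apply/subsetP=> w /setIP[/mem_Beauville_Sigma[i [g wE]]].
  case/mem_Beauville_Sigma=> i' [g' wE']; apply/set1P/ffunP=> j.
  have [c xc wc]: exists2 c,
      c \in [:: x1 j; y1 j; x1 j * y1 j] & w j = (c ^+ i) ^ g j.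
    case: wE => ->; rewrite conjg_ffun expg_ffun ?mulg_ffun;
     by [exists (x1 j); rewrite ?inE ?eqxx
        |exists (y1 j); rewrite ?inE ?eqxx ?orbT
        |exists (x1 j * y1 j); rewrite ?inE ?eqxx ?orbT].
  have [d xd wd]: exists2 d,
      d \in [:: x2 j; y2 j; x2 j * y2 j] & w j = (d ^+ i') ^ g' j.
    case: wE' => ->; rewrite conjg_ffun expg_ffun ?mulg_ffun;
     by [exists (x2 j); rewrite ?inE ?eqxx
        |exists (y2 j); rewrite ?inE ?eqxx ?orbT
        |exists (x2 j * y2 j); rewrite ?inE ?eqxx ?orbT].
  by rewrite oneg_ffun wc; apply: (disj xc xd (etrans (esym wc) wd)).
(* Conjugation by the constant tuple normalises [Alt_power n k] even if [t] is odd, and it inverts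
   all four generators, so [g1 = g2 = 1] suffices. *)
pose tt : {dffun 'I_k -> {perm 'I_n}} := [ffun=> t].
have nAt : tt \in 'N(Alt_power n k).
  rewrite inE; apply/subsetP=> _ /imsetP[g /setXnP Ag ->]; apply/setXnP=> j.
  by rewrite conjg_ffun ffunE memJ_norm // (subsetP (Alt_norm _)) ?inE.
exists (conj_aut (Alt_power n k) tt).
  apply: (subsetP (Aut_conj_aut (Alt_power n k) 'N(Alt_power n k))).
  exact: mem_morphim.
exists 1, 1; rewrite !mul1g !invg1 !mulg1.
have conjE (x : {dffun 'I_k -> {perm 'I_n}}) (y : 'I_k -> {perm 'I_n}) :
    (forall j, <<[set x j; y j]>> = 'Alt_('I_n)) ->
    (forall j, x j ^ t = (x j)^-1) ->
  conj_aut (Alt_power n k) tt x = x^-1.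
  move=> genA xV; rewrite norm_conj_autE //; last first.
    by apply/setXnP=> j; have: x j \in <<[set x j; y j]>>;
      [rewrite mem_gen ?set21 | rewrite genA].
  by apply/ffunP=> j; rewrite conjg_ffun invg_ffun ffunE xV.
split=> //; split.
- by apply: (conjE _ _ gen1) => j; case: (inv_t j).
- by apply: (conjE _ x1) => j; [rewrite setUC | case: (inv_t j)].
- by apply: (conjE _ _ gen2) => j; case: (inv_t j).
- by apply: (conjE _ x2) => j; [rewrite setUC | case: (inv_t j)].
Qed.

End Assembly.

(** * Words that tell the second pairs apart *)

Section Separation.

Variable T : finType.

(** The product consists of the disjoint 3-cycles [(f e p)] and [(f' e' p')]. *)
Lemma swap2_mul_cube (e e' p p' f f' : T) : uniq [:: f; f'; e; e'; p; p'] ->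
  (swap2 e e' f f' * swap2 p p' f f') ^+ 3 = 1.
Proof.
move=> U6.
have cE : commute (tperm f' e') (tperm f p).
  by apply/commgP/conjg_fixP; rewrite tpermJ !tpermD //; uniq_neq U6.
have ->: swap2 e e' f f' * swap2 p p' f f' =
    cyc [:: f; e; p] * cyc [:: f'; e'; p'].
  rewrite !cyc_cons2 /cyc !big_nil !mulg1 /swap2 !mulgA.
  by rewrite -(mulgA _ _ (tperm f p)) cE !mulgA.
rewrite expgMn; last first.
  apply/commgP/conjg_fixP; rewrite cycJ; congr cyc => /=.
  by rewrite !cyc_notin //= ?inE ?negb_or ?andbT; repeat (apply/andP; split);
    try uniq_neq U6.
by rewrite !expg_cyc_eq1 ?mulg1 //= ?inE ?negb_or ?andbT;
  repeat (apply/andP; split); uniq_neq U6.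
Qed.

(** The shared point [e] fuses the two 3-cycles into the 5-cycle [f -> f' -> e' -> e -> p -> f]. *)
Lemma swap2_mul_overlap (e e' p f f' : T) : uniq [:: f; f'; e; e'; p] ->
  (swap2 e e' f f' * swap2 p e f f') ^+ 3 != 1.
Proof.
move=> U5; set h := _ * _.
have hf : h f = f'.
  rewrite !permM tpermL [tperm f' e' e]tpermD ?[tperm f p e]tpermD ?tpermR //;
    uniq_neq U5.
have hf' : h f' = e'.
  rewrite !permM [tperm f e f']tpermD ?tpermL ?[tperm f p e']tpermD;
   rewrite ?[tperm f' e e']tpermD //; uniq_neq U5.
have he' : h e' = e.
  rewrite !permM [tperm f e e']tpermD ?tpermR ?[tperm f p f']tpermD ?tpermL //;
   uniq_neq U5.
apply: contra_notN (_ : e <> f) => [/eqP/permP/(_ f)|].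
  by rewrite expgS permM expgS permM expg1 hf hf' he' perm1.
by move=> ef; move: U5; rewrite ef /= !inE eqxx ?orbT.
Qed.

Lemma swap2J (e e' f f' : T) (g : {perm T}) : g f = f -> g f' = f' ->
  swap2 e e' f f' ^ g = swap2 (g e) (g e') f f'.
Proof. by move=> gf gf'; rewrite conjMg !tpermJ gf gf'. Qed.

(** Modulo the length, [sw c] uses the positions [c] and [-c], and its conjugate uses [c + 2d] and
    [2d - c]. As the length is odd, these four are distinct for [c != d], whereas for [c = d] the
    position [2d - d = d] occurs twice. *)
Lemma separate_swap2 (x0 f f' : T) (s : seq T) c d :
    uniq [:: f, f' & s] -> odd (size s) -> 0 < c -> c.*2 < size s -> 0 < d ->
    d.*2 < size s -> c != d ->
  let sw i := swap2 (nth x0 s i) (nth x0 s (size s - i)) f f' in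
  let h i := (sw i * sw i ^ (cyc s ^+ d.*2)) ^+ 3 in
  h c = 1 /\ h d != 1.
Proof.
move=> Us oN c_gt0 cN d_gt0 dN ne_cd sw h.
move: (Us) => /= /and3P[]; rewrite inE negb_or => /andP[ff' fs] f's Us'.
have swJ i : 0 < i -> i.*2 < size s ->
    sw i ^ (cyc s ^+ d.*2) = swap2 (nth x0 s ((i + d.*2) %% size s))
      (nth x0 s ((size s - i + d.*2) %% size s)) f f'.
  move=> i_gt0 iN.
  rewrite (swap2J _ _ (expg_cyc_notin _ Us' fs) (expg_cyc_notin _ Us' f's)).
  by rewrite !expg_cyc_nth //; lia.
have mod_lt i : i %% size s < size s by rewrite ltn_mod; lia.
(* All positions involved stay below twice the length, so reduction is at most one subtraction,
   which [lia] can handle. *)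
have mod2 i : i < (size s).*2 ->
    i %% size s = if i < size s then i else i - size s.
  move=> iN; case: ltnP => [/modn_small//|sN].
  by rewrite -{1}(subnK sN) modnDr modn_small //; lia.
have nthf i : i < size s -> (f != nth x0 s i) && (f' != nth x0 s i).
  move=> iN; apply/andP; split; [apply: contraNneq fs|apply: contraNneq f's];
    by move->; rewrite mem_nth.
split.
  rewrite /h swJ //; apply: swap2_mul_cube.
  rewrite /= !inE !negb_or ff' !andbT /=.
  have i1 : c < size s by lia.
  have i2 : size s - c < size s by lia.
  have := (nthf _ i1, nthf _ i2, nthf _ (mod_lt (c + d.*2)),
           nthf _ (mod_lt (size s - c + d.*2))).
  case=> [][][] /andP[-> ->] /andP[-> ->] /andP[-> ->] /andP[-> ->] /=.
  rewrite !nth_uniq // !mod2; try lia; do ?case: ltnP => ?; lia.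
rewrite /h swJ //.
have -> : (size s - d + d.*2) %% size s = d.
  by rewrite mod2; [case: ltnP => ?|]; lia.
apply: swap2_mul_overlap.
rewrite /= !inE !negb_or ff' !andbT /=.
have i1 : d < size s by lia.
have i2 : size s - d < size s by lia.
have := (nthf _ i1, nthf _ i2, nthf _ (mod_lt (d + d.*2))).
case=> [][] /andP[-> ->] /andP[-> ->] /andP[-> ->] /=.
rewrite !nth_uniq // !mod2; try lia; do ?case: ltnP => ?; lia.
Qed.

End Separation.

(** * Cycles reversed by an involution with a fixed point *)

Section Palindromes.

Variables (T : finType) (t : {perm T}) (o : T).
Hypotheses (tK : involutive t) (to : t o = o).

(** Positions [i] and [-i] modulo the length are exchanged by [t], so [t] acts on the cycle as the
    reflection through [o]. *)
Definition pal (s : seq T) := o :: s ++ rev (map t s).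

Lemma size_pal s : size (pal s) = (size s).*2.+1.
Proof. by rewrite /= size_cat size_rev size_map addnn. Qed.

Lemma odd_size_pal s : odd (size (pal s)).
Proof. by rewrite size_pal /= odd_double. Qed.

Lemma nth_pal s i : i < size s -> nth o (pal s) i.+1 = nth o s i.
Proof. by move=> lt_i; rewrite /pal /= nth_cat lt_i. Qed.

Lemma nth_pal_sub s i : i < size s ->
  nth o (pal s) (size (pal s) - i.+1) = t (nth o s i).
Proof.
move=> lt_i; rewrite size_pal /pal -cat_cons nth_cat /= ltnNge.
have -> /=: size s < (size s).*2.+1 - i.+1 by lia.
rewrite nth_rev size_map; last by lia.
rewrite (nth_map o); last by lia.
by congr (t (nth _ _ _)); lia.
Qed.

Lemma cyc_palJ s : uniq (pal s) -> cyc (pal s) ^ t = (cyc (pal s))^-1.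
Proof.
move=> Us; rewrite cycJ cycV // /pal rev_cons -cats1 [RHS]cyc_catC; last first.
  by rewrite cats1 -rev_cons rev_uniq.
by rewrite /= to map_cat map_rev rev_cat revK (mapK tK).
Qed.

Lemma pal_catE u v :
  perm_eq (o :: (u ++ rev (map t u)) ++ (v ++ rev (map t v))) (pal (u ++ v)).
Proof.
apply/seq.permP=> p; rewrite /= !count_cat !count_rev map_cat !count_cat; lia.
Qed.

(** The last entry [f] and its image [t f] lie in the middle of the palindrome; taking them out
    leaves a palindrome. *)
Lemma pal_rconsE w f : perm_eq [:: f, t f & pal w] (pal (rcons w f)).
Proof.
apply/seq.permP=> p.
by rewrite /= map_rcons -!cats1 !count_cat !count_rev !count_cat /=; lia.
Qed.

Lemma pal_mul u v : cyc (pal u) * cyc (pal v) =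
  cyc (o :: (u ++ rev (map t u)) ++ (v ++ rev (map t v))).
Proof. by rewrite /cyc big_cat. Qed.

Lemma gen_pal u v : u != [::] -> v != [::] -> uniq (pal (u ++ v)) ->
    (forall z, z \in pal (u ++ v)) ->
  <<[set cyc (pal u); cyc (pal v)]>> = 'Alt_T.
Proof.
move=> u0 v0 Uuv full; have Ur := Uuv; rewrite -(perm_uniq (pal_catE u v)) in Ur.
apply/eqP; rewrite eqEsubset; apply/andP; split; last first.
  apply: Alt_sub_gen_cyc2 => //; last by move=> z; rewrite (perm_mem (pal_catE u v)).
  - by case: (u) u0.
  - by case: (v) v0.
rewrite gen_subG; apply/subsetP=> z /set2P[]->; apply: odd_cyc;
  rewrite ?odd_size_pal //.
  by apply: subseq_uniq Ur; rewrite /= eqxx prefix_subseq.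
by apply: subseq_uniq Ur; rewrite /= eqxx suffix_subseq.
Qed.

(** * The second pairs in palindromic form *)

Section Pair322.

Variables (f a e : T) (u v : seq T).
Hypothesis Uw : uniq (pal (rcons (a :: u ++ e :: v) f)).
Hypothesis full : forall z, z \in pal (rcons (a :: u ++ e :: v) f).

Let w := a :: u ++ e :: v.
Let x := elt322 o a (t a) e (t e) f (t f).

(** This displays the cycle as [o, a, ..., e, ..., t e, ..., t a], the shape that [elt322_mul_cyc]
    requires. *)
Lemma pal_split : pal w =
  [:: o, a & u ++ e :: (v ++ rev (map t v)) ++ t e :: rcons (rev (map t u)) (t a)].
Proof.
rewrite /pal /w /= map_cat /= rev_cons rev_cat rev_cons -cats1 cat_rcons.
by rewrite -!cats1 -!catA /= -?catA.
Qed.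

Lemma uniq7 : uniq [:: f; t f; o; a; t a; e; t e].
Proof.
have: uniq ([:: f; t f; o; a; t a; e; t e] ++
    (u ++ v ++ rev (map t v) ++ rev (map t u))).
  have:= Uw; rewrite -(perm_uniq (pal_rconsE w f)) pal_split => Uw'.
  apply: etrans Uw'; apply: perm_uniq; apply/seq.permP=> p.
  rewrite /= -cats1 !count_cat /= !count_cat /= !count_cat /=; lia.
by rewrite cat_uniq => /and3P[].
Qed.

Lemma full322 z : z \in [:: f, t f & pal w].
Proof. by rewrite (perm_mem (pal_rconsE w f)). Qed.

Lemma uniq322 : uniq [:: f, t f & pal w].
Proof. by rewrite (perm_uniq (pal_rconsE w f)). Qed.

Lemma uniq_pal_w : uniq (pal w).
Proof. by case/and3P: uniq322. Qed.

Lemma pair322_mul :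
  exists s, [/\ uniq s, size s = size (pal w) & x * cyc (pal w) = cyc s].
Proof.
have U := uniq322; rewrite pal_split in U *.
exists (u ++ [:: e, f & v ++ rev (map t v)] ++
  [:: t e, t f & rcons (rev (map t u)) (t a)]); split.
- suff: uniq ([:: o; a] ++ (u ++ [:: e, f & v ++ rev (map t v)] ++
      [:: t e, t f & rcons (rev (map t u)) (t a)])).
    by rewrite cat_uniq => /and3P[].
  apply: etrans U; apply/perm_uniq/seq.permP=> p.
  by rewrite /= !count_cat /= !count_cat /=; lia.
- by rewrite /= !size_cat /= !size_cat /=; lia.
- exact: (elt322_mul_cyc uniq7).
Qed.

Lemma gen_pair322 : <<[set x; cyc (pal w)]>> = 'Alt_T.
Proof.
apply/eqP; rewrite eqEsubset; apply/andP; split; last first.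
  pose r := u ++ e :: (v ++ rev (map t v)) ++ t e :: rev (map t u).
  have palE : pal w = [:: o, a & rcons r (t a)].
    by rewrite pal_split rcons_cat rcons_cons rcons_cat.
  have := uniq322; have := full322; rewrite palE => fullr /and3P[_ _ Ur].
  apply: (Alt_sub_gen322 uniq7) => //.
    by rewrite !(inE, mem_rcons, mem_cat) eqxx ?orbT.
  by rewrite !(inE, mem_rcons, mem_cat) eqxx ?orbT.
rewrite gen_subG; apply/subsetP=> z /set2P[]->; first exact: (elt322_Alt uniq7).
by rewrite odd_cyc ?uniq_pal_w ?odd_size_pal.
Qed.

Lemma pair322J : x ^ t = x^-1.
Proof. by apply: (elt322J uniq7); rewrite ?tK. Qed.

End Pair322.

End Palindromes.

(** * The reflection of ['I_n] and the choice of the pairs *)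

Lemma reflection_exists n : odd n ->
  exists (t : {perm 'I_n}) (o : 'I_n) (W : seq 'I_n),
    [/\ involutive t, t o = o, uniq (pal t o W) & forall z, z \in pal t o W].
Proof.
move=> oddn.
have ltmn : n./2 < n by case: n oddn => // n _; rewrite ltn_half_double; lia.
(* Reversal of ['I_n] fixes the middle point [n./2], as [n] is odd; [W] will list the points above
   it. *)
pose t := perm (@rev_ord_inj n); pose o := Ordinal ltmn.
have tE i : t i = rev_ord i by rewrite permE.
exists t, o, [seq i : 'I_n <- enum 'I_n | o < i].
have tK : involutive t by move=> i; rewrite !tE rev_ordK.
split=> //.
- by rewrite tE; apply: val_inj => /=; lia.
- rewrite /= mem_cat mem_rev mem_filter ltnn /= cat_uniq rev_uniq.
  rewrite (map_inj_uniq perm_inj) filter_uniq ?enum_uniq //= andbT.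
  apply/andP; split.
    apply/mapP=> [[i]]; rewrite mem_filter => /andP[oi _] /(congr1 val).
    by rewrite tE /= => ?; move: oi (ltn_ord i) => /=; lia.
  apply/hasPn=> i; rewrite mem_rev => /mapP[j].
  rewrite !mem_filter tE => /andP[oj _] ->; move: oj => /=; have := ltn_ord j; lia.
move=> z; rewrite inE mem_cat mem_rev mem_filter mem_enum andbT.
case: (ltngtP o z) => /= [oz|zo|oz]; last first.
- by have ->: z = o; [apply: val_inj | rewrite eqxx].
- apply/orP; right; rewrite -[z]tK (mem_map perm_inj) mem_filter mem_enum andbT tE.
  by move: zo (ltn_ord z) => /=; lia.
- by rewrite orbT.
Qed.

Theorem lemma17 (n k : nat) (hn : (11 <= n)%N) (hodd : odd n)
    (hk0 : (0 < k)%N) (hk : (k%:R <= (n%:R - 6%:R) / 2%:R :> rat)%R) :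
  strongly_real_Beauville (Alt_power n k).
Proof.
have {hk}k_le : k.*2 + 6 <= n.
  move: hk; rewrite Num.Theory.ler_pdivlMr // Num.Theory.lerBrDr.
  by rewrite -!(GRing.natrM, GRing.natrD) Num.Theory.ler_nat muln2.
have [t [o [W [tK to UW fullW]]]] := reflection_exists hodd.
have sizeW : (size W).*2.+1 = n.
  rewrite -(size_pal t o) -(card_uniqP UW) -[RHS]card_ord.
  by apply: eq_card => z; rewrite fullW.
(* The bound on [k] enters here: as [n] is twice [size W] plus 1, it says that [k] is at most
   [size W - 3]. *)
have jk (j : 'I_k) : j.+3 < size W by have := ltn_ord j; lia.
case/lastP: W UW fullW sizeW jk => [|[|a w] f] UW fullW sizeW jk;
  try by move: sizeW => /=; lia.
pose W := rcons (a :: w) f; rewrite -/W in UW fullW sizeW jk.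
have sizew : size w = (size W).-2 by rewrite size_rcons.
have sizeaw : size (a :: w) = (size W).-1 by rewrite size_rcons.
pose x1 : {dffun 'I_k -> {perm 'I_n}} :=
  [ffun j : 'I_k => cyc (pal t o (take j.+2 W))].
pose y1 : {dffun 'I_k -> {perm 'I_n}} :=
  [ffun j : 'I_k => cyc (pal t o (drop j.+2 W))].
(* Index [j] in [w] is index [j + 2] in [pal t o (a :: w)], after [o] and [a]. *)
pose x2 : {dffun 'I_k -> {perm 'I_n}} := [ffun j : 'I_k =>
  elt322 o a (t a) (nth o w j) (t (nth o w j)) f (t f)].
pose y2 : {dffun 'I_k -> {perm 'I_n}} :=
  [ffun j : 'I_k => cyc (pal t o (a :: w))].
have catW (j : 'I_k) : take j.+2 W ++ drop j.+2 W = W by rewrite cat_take_drop.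
have catw (j : 'I_k) : w = take j w ++ nth o w j :: drop j.+1 w.
  by rewrite -drop_nth ?cat_take_drop // sizew; have := jk j; lia.
have size_takeW (j : 'I_k) : size (take j.+2 W) = j.+2.
  by rewrite size_takel //; have := jk j; lia.
have size_dropW (j : 'I_k) : size (drop j.+2 W) = size W - j.+2.
  by rewrite size_drop.
have U1 (j : 'I_k) : uniq (o :: (take j.+2 W ++ rev (map t (take j.+2 W))) ++
    (drop j.+2 W ++ rev (map t (drop j.+2 W)))).
  by rewrite (perm_uniq (pal_catE _ _ _ _)) catW.
have Ux1 (j : 'I_k) : uniq (pal t o (take j.+2 W)).
  by have := U1 j; rewrite -cat_cons cat_uniq => /andP[].
have Uy1 (j : 'I_k) : uniq (pal t o (drop j.+2 W)).
  apply: subseq_uniq (U1 j).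
  exact: (cat_subseq (subseq_refl [:: o]) (suffix_subseq _ _)).
have U2 (j : 'I_k) :
    uniq (pal t o (rcons (a :: take j w ++ nth o w j :: drop j.+1 w) f)).
  by rewrite -catw.
have full2 (j : 'I_k) z :
    z \in pal t o (rcons (a :: take j w ++ nth o w j :: drop j.+1 w) f).
  by rewrite -catw.
apply: (@strongly_real_Alt_power n k x1 y1 x2 y2 t).
- by lia.
- move=> j; rewrite !ffunE; apply: gen_pal.
  + by rewrite -size_eq0 size_takeW.
  + by rewrite -size_eq0 size_dropW; have := jk j; lia.
  + by rewrite catW.
  + by rewrite catW.
- move=> j; rewrite !ffunE {3}(catw j).
  exact: gen_pair322 (U2 j) (full2 j).
- move=> i j ne_ij; have [lt_ij|lt_ji|/val_inj eq_ij] := ltngtP i j.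
  (* The length of [x1 i] grows with [i] and that of [y1 i] shrinks. So, for [x1] if [i < j] and for
     [y1] otherwise, the length at [i] is an exponent trivial at [i] but too small to be trivial at
     [j]. *)
  + exists (x1 ^+ size (pal t o (take i.+2 W))); split.
    * by rewrite groupX ?mem_gen ?set21.
    * by rewrite expg_ffun ffunE expg_cyc_eq1.
    * by rewrite expg_ffun ffunE expg_cyc_neq1 // !size_pal !size_takeW; lia.
  + exists (y1 ^+ size (pal t o (drop i.+2 W))); split.
    * by rewrite groupX ?mem_gen ?set22.
    * by rewrite expg_ffun ffunE expg_cyc_eq1.
    * rewrite expg_ffun ffunE expg_cyc_neq1 // !size_pal !size_dropW.
      have := jk i; lia.
  + by rewrite eq_ij eqxx in ne_ij.
- move=> i j ne_ij.
  (* The shift by [2(j + 2)] creates the overlap at coordinate [j] and at no other. *)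
  exists ((x2 ^+ 3 * (x2 ^+ 3) ^ (y2 ^+ (j.+2).*2)) ^+ 3).
  have swE (l : 'I_k) : (x2 l) ^+ 3 =
      swap2 (nth o (pal t o (a :: w)) l.+2)
        (nth o (pal t o (a :: w)) (size (pal t o (a :: w)) - l.+2)) f (t f).
    rewrite ffunE (elt322_exp3 (uniq7 (U2 l))).
    have lt_l : l.+1 < size (a :: w) by rewrite sizeaw; have := jk l; lia.
    by rewrite nth_pal ?nth_pal_sub.
  have Uf : uniq [:: f, t f & pal t o (a :: w)].
    by rewrite (perm_uniq (pal_rconsE _ _ _ _)).
  have lt2 (l : 'I_k) : (l.+2).*2 < size (pal t o (a :: w)).
    by rewrite size_pal /= sizew; have := jk l; lia.
  have [|h1 h2] := separate_swap2 o Uf (odd_size_pal t o _) (ltn0Sn _) (lt2 i)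
    (ltn0Sn _) (lt2 j).
    by [].
  split.
  + have Hx : x2 \in <<[set x2; y2]>> by rewrite mem_gen ?set21.
    have Hy : y2 \in <<[set x2; y2]>> by rewrite mem_gen ?set22.
    by apply: groupX; apply: groupM; [|apply: groupJ]; apply: groupX.
  + by rewrite expg_ffun mulg_ffun conjg_ffun !expg_ffun !swE [y2 i]ffunE.
  + by rewrite expg_ffun mulg_ffun conjg_ffun !expg_ffun !swE [y2 j]ffunE.
- move=> j c d i g i' g' xc xd.
  (* With [m = size W], the palindromes come from lists of lengths [j + 2], [m - j - 2] and [m]. By
     [jk] these are at least 2 and differ from [m - 1], the length of [a :: w]. *)
  have [s [Us s_gt4 ne_s ->]]: exists s, [/\ uniq s, 4 < size s,
      size s != size (pal t o (a :: w)) & c = cyc s].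
    move: xc; rewrite !inE => /or3P[]/eqP->.
    + exists (pal t o (take j.+2 W)); rewrite ffunE !size_pal size_takeW sizeaw.
      by split=> //; have := jk j; lia.
    + exists (pal t o (drop j.+2 W)); rewrite ffunE !size_pal size_dropW sizeaw.
      by split=> //; have := jk j; lia.
    + exists (o :: (take j.+2 W ++ rev (map t (take j.+2 W))) ++
        (drop j.+2 W ++ rev (map t (drop j.+2 W)))).
      rewrite (perm_size (pal_catE _ _ _ _)) catW !size_pal sizeaw !ffunE pal_mul.
      split=> //; move: (jk j); move: (size W) (nat_of_ord j) => N q; lia.
  have [d322|[s' [Us' size_s' ->]]] : d = x2 j \/ exists s', [/\ uniq s',
      size s' = size (pal t o (a :: w)) & d = cyc s'].
    move: xd; rewrite !inE => /or3P[]/eqP->; [by left|right..].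
    + exists (pal t o (a :: w)); split=> //; last by rewrite ffunE.
      by move: (uniq_pal_w (U2 j)); rewrite -catw.
    + have [s' [Us' sz E]] := pair322_mul (U2 j).
      by rewrite -catw in sz E; exists s'; rewrite !ffunE.
  + rewrite d322 ffunE => E.
    exact: (elt322_conj_eq1 (uniq7 (U2 j)) Us s_gt4 E (erefl _)).
  + by apply: cyc_expg_conj_eq1 => //; rewrite size_s'.
- move=> j; rewrite !ffunE; split.
  + exact: cyc_palJ.
  + exact: cyc_palJ.
  + exact: (pair322J tK to (U2 j)).
  + by apply: cyc_palJ => //; move: (uniq_pal_w (U2 j)); rewrite -catw.
Qed.
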